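(* Let $\rho\in R_k$ have arity $n+2$, suppose $[\{\rho\}]$ contains only finitely many essential predicates, and let $\rho_0(y)=\exists x_1\dots\exists x_n\,\rho(y,y,x_1,\dots,x_n)$. Then $$\exists y\,\rho(y,y,x_1,\dots,x_n)=\exists y_0\exists y_1\dots\exists y_k\Big(\bigwedge_{0\le i\le k-1}\rho(y_i,y_{i+1},x_1,\dots,x_n)\Big)\wedge\Big(\bigwedge_{0\le i\le k}\rho_0(y_i)\Big).$$
   Context: $E_k=\{0,\dots,k-1\}$; $R_k$ is the set of all predicates $E_k^n\to\{0,1\}$, $n\ge0$. For $S\subseteq R_k$, $[S]$ is the set of all predicates expressible by a formula $\exists y_1\dots\exists y_l$ (conjunction of atoms $\rho_i(z_{i,1},\dots,z_{i,n_i})$) with $\rho_i\in S\cup\{=,\mathrm{false}\}$ ($=$ binary equality, $\mathrm{false}$ the $0$-ary predicate with value $0$). A predicate of arity $n$ is essential if it cannot be written as a conjunction of predicates of arity $<n$ each applied to pairwise distinct variables among its $n$ variables. *)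

(* Defs.v *)
From HB Require Import structures.
From mathcomp Require Import all_boot.
From mathcomp Require Import boolp classical_sets functions cardinality.

Set Implicit Arguments.
Unset Strict Implicit.
Unset Printing Implicit Defensive.

Local Open Scope classical_set_scope.

Definition npred (k n : nat) := {ffun n.-tuple 'I_k -> bool}.

(* The tag is the arity; equality on [Rk k] is equality of arities and extensional
   equality of predicates. *)
Definition Rk (k : nat) := {n : nat & npred k n}.

Definition arity (k : nat) (p : Rk k) : nat := tag p.

Definition pred_of (k : nat) (p : Rk k) : npred k (arity p) := tagged p.

Definition mkRk (k n : nat) (p : npred k n) : Rk k := Tagged (npred k) p.

Definition eq_pred (k : nat) : npred k 2 :=
  [ffun t : 2.-tuple 'I_k => tnth t ord0 == tnth t ord_max].

Definition false_pred (k : nat) : npred k 0 := [ffun=> false].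

(* An atom r(z_1, ..., z_m) over the set of variables V. *)
Definition atom (k : nat) (V : eqType) := {r : Rk k & (arity r).-tuple V}.

Definition atom_sat (k : nat) (V : eqType) (v : V -> 'I_k) (a : atom k V) : bool :=
  pred_of (tag a) (map_tuple v (tagged a)).

(* A list stands for the conjunction of its atoms; the empty conjunction is true. *)
Definition conj_sat (k : nat) (V : eqType) (v : V -> 'I_k) (phi : seq (atom k V)) : bool :=
  all (atom_sat v) phi.

Definition valuation (k n l : nat) (x : n.-tuple 'I_k) (y : l.-tuple 'I_k)
    (z : 'I_n + 'I_l) : 'I_k :=
  match z with inl i => tnth x i | inr j => tnth y j end.

(* The set [S]: inl i is the i-th free variable, inr j the j-th bound variable. *)
Definition pp_closure (k : nat) (S : set (Rk k)) : set (Rk k) :=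
  [set p | exists (l : nat) (phi : seq (atom k ('I_(arity p) + 'I_l)%type)),
      (forall a, a \in phi ->
         (S `|` [set mkRk (eq_pred k); mkRk (false_pred k)]) (tag a)) /\
      (forall x : (arity p).-tuple 'I_k,
         pred_of p x = [exists y : l.-tuple 'I_k, conj_sat (valuation x y) phi])].

(* The conjuncts are arbitrary predicates of smaller arity, not only those of some [S]. *)
Definition essential (k : nat) (p : Rk k) : Prop :=
  ~ exists phi : seq (atom k 'I_(arity p)),
      (forall a, a \in phi -> arity (tag a) < arity p /\ uniq (tagged a)) /\
      (forall x : (arity p).-tuple 'I_k, pred_of p x = conj_sat (tnth x) phi).

(* Main.v *)
Require Import Defs.
From HB Require Import structures.
From mathcomp Require Import all_boot zify.
From mathcomp Require Import boolp classical_sets functions cardinality.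

(* If all essential predicates of [[rho]] have arity at most N, every predicate of
   [[rho]] is determined by its projections to N coordinates, and rho is preserved by
   a near-unanimity operation f of arity N + 1 (Baker-Pixley).  Fix x and consider
   the digraph a -> b iff rho(a, b, x).  By pigeonhole, the right-hand side gives a closed
   walk inside rho_0.  Each y in rho_0 has a loop rho(y, y, x') for some x', and f maps
   (x, .., x', .., x) to x, so f preserves the digraph even if one of the edges is
   replaced by such a loop.  A minimal f-closed subset of rho_0 carrying a closed walk
   is then a single vertex with a loop. *)

Set Implicit Arguments.
Unset Strict Implicit.
Unset Printing Implicit Defensive.

(** * Loops in digraphs with an absorbing operation *)

Section ClosedWalks.
Variables (T : finType) (E : rel T).
Implicit Types (A X Y : {set T}).

(** The walk is an infinite periodic sequence, so its indices can be shifted freely; vertices may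
    repeat within a period. *)
Definition closed_walk A (m : nat) (c : nat -> T) :=
  [/\ 0 < m, forall i, c (i + m) = c i, forall i, E (c i) (c i.+1)
    & forall i, c i \in A].

(** Two of the [#|T| + 1] vertices coincide, and the segment between them is repeated
    periodically. *)
Lemma closed_walk_of_walk A (y : nat -> T) :
  (forall t, t < #|T| -> E (y t) (y t.+1)) -> (forall t, t <= #|T| -> y t \in A) ->
  exists m c, closed_walk A m c.
Proof.
move=> yE yA.
have [i [j [ltij lej eqij]]] : exists i j, [/\ i < j, j <= #|T| & y i = y j].
  have /injectivePn[i [j neij eqij]] : ~~ injectiveb (fun i : 'I_#|T|.+1 => y i).
    by apply/negP => /injectiveP /leq_card; rewrite card_ord ltnn.
  wlog ltij : i j neij eqij / i < j.
    move=> wl; have [/wl|/wl|/val_inj eqv] := ltngtP i j; first exact.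
      by apply=> //; rewrite eq_sym.
    by rewrite eqv eqxx in neij.
  by exists i, j; split=> //; rewrite -ltnS.
have mgt0 : 0 < j - i by rewrite subn_gt0.
have bnd t : t %% (j - i) < j - i by rewrite ltn_mod.
exists (j - i), (fun t => y (i + t %% (j - i))); split=> // t.
- by rewrite modnDr.
- have := bnd t; set s := t %% (j - i) => lts.
  have -> : t.+1 %% (j - i) = s.+1 %% (j - i) by rewrite -[in LHS]addn1 -modnDml addn1.
  have Es : E (y (i + s)) (y (i + s).+1) by apply: yE; lia.
  move: lts; rewrite leq_eqVlt => /predU1P[eqs|lts]; last by rewrite (modn_small lts) addnS.
  by rewrite eqs modnn addn0 eqij; have <- : (i + s).+1 = j by lia.
- by apply: yA; have := bnd t; lia.
Qed.

(** Its [n]-th iterate on [[set a]] collects the ends of the walks of length [n] from [a] whose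
    later vertices stay in [A]. *)
Definition out A X : {set T} := [set b in A | [exists a in X, E a b]].

Lemma outP A X b : reflect (b \in A /\ exists2 a, a \in X & E a b) (b \in out A X).
Proof.
rewrite inE; apply: (iffP andP) => -[bA]; first by case/exists_inP=> a; split=> //; exists a.
by case=> a aX Eab; split=> //; apply/exists_inP; exists a.
Qed.

Lemma outS A X Y : X \subset Y -> out A X \subset out A Y.
Proof.
move/fintype.subsetP=> XY; apply/fintype.subsetP=> b /outP[bA [a aX Eab]].
by apply/outP; split=> //; exists a => //; apply: XY.
Qed.

Lemma iter_outS A n X Y : X \subset Y -> iter n (out A) X \subset iter n (out A) Y.
Proof. by move=> XY; elim: n => //= n; apply: outS. Qed.

Lemma iter_out_trans A p q a b d :
  b \in iter p (out A) [set a] -> d \in iter q (out A) [set b] ->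
  d \in iter (q + p) (out A) [set a].
Proof.
move=> ab; apply: fintype.subsetP; rewrite iterD; apply: iter_outS.
by rewrite finset.sub1set.
Qed.

Lemma iter_out_walk A (w : nat -> T) n :
  (forall t, t < n -> E (w t) (w t.+1)) -> (forall t, w t \in A) ->
  w n \in iter n (out A) [set w 0].
Proof.
move=> wE wA; elim: n wE => [|n IHn] wE; first by rewrite inE.
rewrite iterS; apply/outP; split=> //.
exists (w n); last exact: wE.
by apply: IHn => t ltn; apply: wE; apply: ltnW.
Qed.

(** Every vertex of [X] has an in-neighbour in [X], so a backward walk never has to leave [X]. *)
Lemma closed_walk_of_sub_out A X : X != finset.set0 -> X \subset out A X ->
  exists m c, closed_walk X m c.
Proof.
case/finset.set0Pn=> x xX /fintype.subsetP Xout.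
pose g b := odflt b [pick a in X | E a b].
have gP b : b \in X -> g b \in X /\ E (g b) b.
  move=> bX; rewrite /g; case: pickP => [a /andP[]//|no].
  by case/outP: (Xout b bX) => _ [a aX Eab]; move: (no a); rewrite aX Eab.
have gX t : iter t g x \in X by elim: t => //= t /gP[].
(* The backward walk is read in reverse, so that its edges point forward. *)
apply: (@closed_walk_of_walk X (fun t => iter (#|T| - t) g x)) => t ltt; last exact: gX.
have -> : #|T| - t = (#|T| - t.+1).+1 by lia.
by rewrite iterS; have [] := gP _ (gX (#|T| - t.+1)).
Qed.

Variables (r : nat) (f : {ffun 'I_r.+1 -> T} -> T).

Definition stable A := forall u : {ffun 'I_r.+1 -> T}, (forall i, u i \in A) -> f u \in A.

Hypothesis f_idem : forall a, f [ffun=> a] = a.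
Hypothesis f_pres : forall u v : {ffun 'I_r.+1 -> T},
  (forall i, E (u i) (v i)) -> E (f u) (f v).

(** In-neighbours chosen in [X] for the arguments are sent by [f] to an in-neighbour of the
    result. *)
Lemma stable_out A X : stable A -> stable X -> stable (out A X).
Proof.
move=> sA sX u uout.
pose v : {ffun 'I_r.+1 -> T} := [ffun i => odflt (u i) [pick a in X | E a (u i)]].
have vP i : v i \in X /\ E (v i) (u i).
  rewrite ffunE; case: pickP => [a /andP[]//|no].
  by case/outP: (uout i) => _ [a aX Ea]; move: (no a); rewrite aX Ea.
apply/outP; split; first by apply: sA => i; case/outP: (uout i).
exists (f v); first by apply: sX => i; case: (vP i).
by apply: f_pres => i; case: (vP i).
Qed.

Lemma stable1 a : stable [set a].
Proof.
move=> u ua; suff -> : u = [ffun=> a] by rewrite f_idem inE.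
by apply/ffunP=> i; rewrite ffunE; apply/finset.set1P.
Qed.

Lemma stable_iter_out A n a : stable A -> stable (iter n (out A) [set a]).
Proof. by move=> sA; elim: n => [|n]; [apply: stable1 | apply: stable_out]. Qed.

(** One argument may rest at a vertex of [A] while the others move along edges, even if that vertex
    has no loop. *)
Definition absorbs A := forall i (u v : {ffun 'I_r.+1 -> T}),
  u i = v i -> u i \in A -> (forall j, j != i -> E (u j) (v j)) -> E (f u) (f v).

(* The terms [f (x, .., x, y, z, .., z)] are directed Jonsson terms.  Moving the two
   outer blocks once around the closed walk while [y] stays put replaces one [x] by [z]
   in [m - 1] steps. *)
Lemma closed_walk_coprime A m c : stable A -> absorbs A -> closed_walk A m c ->
  c 0 \in iter (r.+1 * m).-1 (out A) [set c 0].
Proof.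
move=> sA abA [mgt0 cm cE cA].
have cmM n i : c (i + n * m) = c i.
  by elim: n => [|n IHn]; rewrite ?addn0 // mulSn addnCA addnC cm.
pose h i s := f [ffun j : 'I_r.+1 => if j < i then c s else c s.+1].
have step (i : 'I_r.+1) s : h i (s + m.-1) \in iter m.-1 (out A) [set h i.+1 s].
  (* Argument [i] rests at [c s]. After [m.-1] moves, [c s = c (s + m)] is the value of the
     right-hand block, which it joins. *)
  pose w t := f [ffun j : 'I_r.+1 => if j < i then c (s + t) else
                                     if j == i then c s else c (s + t).+1].
  have <- : w 0 = h i.+1 s.
    congr f; apply/ffunP=> j; rewrite !ffunE addn0 ltnS.
    by have [| |/val_inj->] //= := ltngtP j i; rewrite ?eqxx // => lt; rewrite -val_eqE /= gtn_eqF.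
  have <- : w m.-1 = h i (s + m.-1).
    congr f; apply/ffunP=> j; rewrite !ffunE.
    case: ifP => // _; case: eqP => // _.
    by rewrite -addnS prednK // cm.
  apply: iter_out_walk => [t _|t]; last by apply: sA => j; rewrite ffunE; do 2?case: ifP.
  apply: (abA i); rewrite ?ffunE ?ltnn ?eqxx // => j ne.
  by rewrite !ffunE (negPf ne) addnS; case: ifP.
have steps i s : i <= r.+1 ->
    h 0 (s + i * m.-1) \in iter (i * m.-1) (out A) [set h i s].
  elim: i s => [|i IHi] s lei; first by rewrite !mul0n addn0 inE.
  rewrite mulSn addnA [m.-1 + _]addnC.
  exact: iter_out_trans (step (Ordinal lei) s) (IHi _ (ltnW lei)).
have h0 s : h 0 s = c s.+1.
  by rewrite -[RHS]f_idem; congr f; apply/ffunP=> j; rewrite !ffunE.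
have hr s : h r.+1 s = c s.
  by rewrite -[RHS]f_idem; congr f; apply/ffunP=> j; rewrite !ffunE ltn_ord.
have := steps r.+1 0 (leqnn _); rewrite h0 hr add0n => W1.
(* So far one position along [c] has been gained over the number of steps made; [r] ordinary edges
   then lead to index [r.+1 * m], which is [c 0] again. *)
have := @iter_out_walk A (fun t => c ((r.+1 * m.-1).+1 + t)) r.
rewrite addn0 => W2.
have -> : (r.+1 * m).-1 = r + r.+1 * m.-1 by nia.
have {1}<- : c ((r.+1 * m.-1).+1 + r) = c 0.
  by rewrite -(cmM r.+1 0); congr c; nia.
by apply: iter_out_trans W1 (W2 _ _) => [t _|t] //; rewrite addnS.
Qed.

(** There are walks from [c 0] to itself of lengths [m] and [(r.+1 * m).-1]. The first makes the
    iterates at multiples of [m] increase until they stabilise; the second, one short of a multiple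
    of [m], makes up for one further step of [out]. *)
Lemma iter_out_saturates A m c : stable A -> absorbs A -> closed_walk A m c ->
  exists n, let U := iter n (out A) [set c 0] in out A U = U.
Proof.
move=> sA abA cw; have W := closed_walk_coprime sA abA cw.
case: cw => mgt0 cm cE cA.
pose X n := iter n (out A) [set c 0].
have mono s n : c 0 \in X s -> X n \subset X (n + s).
  by move=> cs; rewrite /X iterD; apply: iter_outS; rewrite finset.sub1set.
have cXm : c 0 \in X m.
  by rewrite -[X in X \in _](cm 0) add0n; apply: iter_out_walk.
have monom n q : X n \subset X (n + q * m).
  elim: q => [|q IHq]; first by rewrite addn0.
  by apply: fintype.subset_trans IHq _; rewrite mulSnr addnA; apply: mono.
have [t Xt] : exists t, X (t.+1 * m) = X (t * m).
  apply/not_existsP => neX.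
  have grow t : t < #|X (t * m)|.
    elim: t => [|t IHt]; first by rewrite cards1.
    apply: leq_ltn_trans IHt _; apply: proper_card; rewrite finset.properEneq.
    have := monom (t * m) 1; rewrite mul1n addnC -mulSn => ->; rewrite andbT.
    by apply/eqP => /esym; apply: neX.
  by have := grow #|T|; rewrite ltnNge max_card.
have XS n : X (n.+1 * m) = iter m (out A) (X (n * m)) by rewrite /X mulSn iterD.
have Xq q : X ((t + q) * m) = X (t * m).
  elim: q => [|q IHq]; first by rewrite addn0.
  by rewrite addnS XS IHq -XS.
exists (t * m) => /=; rewrite -/(X (t * m)).
have outU : out A (X (t * m)) \subset X (t * m).
  have := mono _ (t * m).+1 W.
  have -> : (t * m).+1 + (r.+1 * m).-1 = (t + r.+1) * m by nia.
  by rewrite Xq.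
(* As [out] shrinks the stable set, all its later iterates lie in the first one; the [m]-th is the
   set itself. *)
have anti q : iter q.+1 (out A) (X (t * m)) \subset out A (X (t * m)).
  elim: q => [|q IHq]; first exact: fintype.subxx.
  rewrite iterS; apply: outS.
  exact: fintype.subset_trans IHq outU.
apply/eqP; rewrite finset.eqEsubset outU /= -{1}Xt XS.
by have := anti m.-1; rewrite prednK.
Qed.

(* For a minimal stable [A] carrying a closed walk through [c0], the saturated set
   [out^n {c0}] is all of [A]; if [n > 0] is least, [out^(n-1) {c0}] is a smaller set. *)
Lemma absorbing_loop A m c : stable A -> absorbs A -> closed_walk A m c ->
  exists a, E a a.
Proof.
have [N] := ubnP #|A|; elim: N A m c => // N IHN A m c leA sA abA cw.
have smaller B m' c' : stable B -> B \proper A -> closed_walk B m' c' -> exists a, E a a.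
  move=> sB BA cwB; apply: (IHN B m' c') => //.
    exact: leq_trans (proper_card BA) leA.
  by move=> i u v uv uB; apply: abA => //; apply: (fintype.subsetP (proper_sub BA)).
have outA X : out A X \subset A by apply/fintype.subsetP=> b /outP[].
have [mgt0 cm cE cA] := cw.
have iterA n : iter n (out A) [set c 0] \subset A.
  by case: n => [|n]; [rewrite finset.sub1set | apply: outA].
have [n0 /= Un0] := iter_out_saturates sA abA cw.
pose U := iter n0 (out A) [set c 0].
have cn0D e : c (n0 + e) \in U.
  elim: e => [|e IHe]; first by rewrite addn0; apply: iter_out_walk.
  by rewrite addnS -[U]Un0; apply/outP; split=> //; exists (c (n0 + e)).
have cmM p j : c (j + p * m) = c j.
  by elim: p => [|p IHp]; rewrite ?addn0 // mulSnr addnA cm.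
have cU i : c i \in U.
  have le_n0 : n0 <= i + n0 * m by nia.
  by rewrite -(cmM n0) -(subnKC le_n0); apply: cn0D.
have [UA|neU] := eqVneq U A; last first.
  apply: (smaller U m c); [exact: stable_iter_out | | by split].
  by rewrite finset.properEneq neU iterA.
have exn : exists n, iter n (out A) [set c 0] == A by exists n0; rewrite -/U UA.
case: (ex_minnP exn) => -[|n] /eqP Xn minn.
  (* Here [A] is the singleton of [c 0], so the edge leaving [c 0] is a loop. *)
  exists (c 0); have := cE 0; have := cA 1; rewrite -Xn => /finset.set1P ->; exact.
pose B := iter n (out A) [set c 0].
have BA : B \proper A.
  by rewrite finset.properEneq iterA andbT; apply/negP => /minn; rewrite ltnn.
have B0 : B != finset.set0.
  apply/negP => /eqP eB; have := cA 0; rewrite -Xn iterS -/B eB.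
  by case/outP=> _ [a]; rewrite inE.
(* By the choice of [n], [out A B] is all of [A] and so contains [B]. *)
have [|m' [c' cwB]] := @closed_walk_of_sub_out A B B0.
  by rewrite [out A B]Xn iterA.
by apply: smaller BA cwB; apply: stable_iter_out.
Qed.

End ClosedWalks.

(** * Primitive positive formulas over an arbitrary finite set of variables *)

Definition rename_atom (k : nat) (V W : eqType) (h : V -> W) (a : atom k V) : atom k W :=
  existT (fun p : Rk k => (arity p).-tuple W) (tag a) (map_tuple h (tagged a)).

Lemma rename_atom_sat (k : nat) (V W : eqType) (h : V -> W) (w : W -> 'I_k) a :
  atom_sat w (rename_atom h a) = atom_sat (w \o h) a.
Proof. by rewrite /atom_sat /=; congr (pred_of _ _); apply: val_inj; rewrite /= -map_comp. Qed.

Lemma eq_atom_sat (k : nat) (V : eqType) (v w : V -> 'I_k) (a : atom k V) :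
  {in tagged a, v =1 w} -> atom_sat v a = atom_sat w a.
Proof.
by move=> vw; rewrite /atom_sat; congr (pred_of _ _); apply: val_inj; apply/eq_in_map.
Qed.

Definition equality_atom (k : nat) (V : eqType) (x y : V) : atom k V :=
  existT (fun p : Rk k => (arity p).-tuple V) (mkRk (eq_pred k)) [tuple x; y].

Lemma equality_atom_sat (k : nat) (V : eqType) (v : V -> 'I_k) (x y : V) :
  atom_sat v (equality_atom k x y) = (v x == v y).
Proof. by rewrite /atom_sat /= /pred_of /= ffunE !(tnth_nth (v x)). Qed.

(** Any finite type can serve as the set of variables; [g] names the free ones, possibly with
    repetitions. *)
Definition exists_pred (k m : nat) (W : finType) (g : 'I_m -> W) (phi : seq (atom k W)) :
    npred k m :=
  [ffun z : m.-tuple 'I_k =>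
    [exists w : {ffun W -> 'I_k}, [forall i, w (g i) == tnth z i] && conj_sat w phi]].

Lemma exists_predP (k m : nat) (W : finType) (g : 'I_m -> W) (phi : seq (atom k W)) z :
  reflect (exists w : W -> 'I_k, (forall i, w (g i) = tnth z i) /\ conj_sat w phi)
          (exists_pred g phi z).
Proof.
rewrite ffunE; apply: (iffP existsP) => -[w].
  by case/andP=> /forallP wg ws; exists w; split=> // i; apply/eqP.
case=> wg ws; exists (finfun w); apply/andP; split.
  by apply/forallP=> i; rewrite ffunE wg.
by apply/allP=> a /(allP ws); rewrite (@eq_atom_sat _ _ (finfun w) w) // => x _; rewrite ffunE.
Qed.

(** * Decomposition of predicates into projections of bounded arity *)

Section Decomposition.
Variables (k : nat) (S : set (Rk k)).

Definition pp_atom (V : eqType) (a : atom k V) :=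
  (S `|` [set mkRk (eq_pred k); mkRk (false_pred k)])%classic (tag a).

(** All of [W] becomes bound, and equality atoms tie each free variable to its image under [g]. *)
Lemma pp_closure_exists m (W : finType) (g : 'I_m -> W) (phi : seq (atom k W)) :
  (forall a, a \in phi -> pp_atom a) -> pp_closure S (mkRk (exists_pred g phi)).
Proof.
move=> phiS.
pose h (x : W) : 'I_m + 'I_#|W| := inr (enum_rank x).
exists #|W|, (map (rename_atom h) phi ++
  [seq equality_atom k (inl i) (h (g i)) | i <- enum 'I_m]); split.
  move=> a; rewrite mem_cat => /orP[] /mapP[b bin ->]; first exact: (phiS b bin).
  by right; left.
move=> z; rewrite -[pred_of _ z]/(exists_pred g phi z); apply/exists_predP/existsP.
  case=> w [wg ws]; exists [tuple w (enum_val i) | i < #|W|].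
  rewrite /conj_sat all_cat; apply/andP; split.
    rewrite all_map; apply/allP=> a ain /=; rewrite rename_atom_sat.
    rewrite (@eq_atom_sat _ _ _ w) ?(allP ws) // => x _.
    by rewrite /= tnth_mktuple enum_rankK.
  rewrite all_map; apply/allP=> i _ /=; rewrite equality_atom_sat /=.
  by rewrite tnth_mktuple enum_rankK wg.
case=> y; rewrite /conj_sat all_cat !all_map => /andP[ws ye].
exists (valuation z y \o h); split.
  move=> i; have := allP ye i; rewrite -enumT mem_enum => /(_ isT).
  by rewrite /= equality_atom_sat => /eqP.
by apply/allP=> a /(allP ws) /=; rewrite rename_atom_sat.
Qed.

Definition project (n m : nat) (p : npred k n) (g : 'I_m -> 'I_n) : npred k m :=
  [ffun z : m.-tuple 'I_k => [exists x : n.-tuple 'I_k,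
     p x && [forall i, tnth x (g i) == tnth z i]]].

Lemma projectP (n m : nat) (p : npred k n) (g : 'I_m -> 'I_n) z :
  reflect (exists2 x, p x & forall i, tnth x (g i) = tnth z i) (project p g z).
Proof.
rewrite ffunE; apply: (iffP existsP) => [[x /andP[px /forallP xg]]|[x px xg]].
  by exists x => // i; apply/eqP.
by exists x; rewrite px; apply/forallP=> i; apply/eqP.
Qed.

Lemma pp_closure_project (n m : nat) (p : npred k n) (g : 'I_m -> 'I_n) :
  pp_closure S (mkRk p) -> pp_closure S (mkRk (project p g)).
Proof.
case=> l [phi [/= phiS phiE]].
rewrite [project p g](_ : _ = exists_pred (fun i => inl (g i) : 'I_n + 'I_l) phi).
  exact: pp_closure_exists.
apply/ffunP=> z; apply/projectP/exists_predP.
  case=> x; rewrite -[p x]/(pred_of (mkRk p) x) phiE => /existsP[y xy] xg.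
  by exists (valuation x y).
case=> w [wg ws]; exists [tuple w (inl i) | i < n]; last by move=> i; rewrite tnth_mktuple.
rewrite -[p _]/(pred_of (mkRk p) _) phiE; apply/existsP.
exists [tuple w (inr i) | i < l]; apply/allP=> a /(allP ws).
by rewrite (@eq_atom_sat _ _ w (valuation [tuple w (inl i) | i < n] [tuple w (inr i) | i < l])) //;
  case=> i _ /=; rewrite tnth_mktuple.
Qed.

Variable N : nat.
Hypothesis essential_le : forall p, pp_closure S p -> essential p -> arity p <= N.

(* By induction on [#|J|]: for [#|J| > N] the projection to [J] is not essential, so
   it is a conjunction of atoms each of which misses some coordinate in [J]. *)
Lemma pp_closure_decomposable (n : nat) (p : npred k n) (x : n.-tuple 'I_k) :
  pp_closure S (mkRk p) ->
  (forall J : {set 'I_n}, #|J| <= N ->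
     exists2 x', p x' & {in J, tnth x' =1 tnth x}) ->
  p x.
Proof.
move=> pS small.
suff all_J (J : {set 'I_n}) : exists2 x', p x' & {in J, tnth x' =1 tnth x}.
  have [x' px' eqx] := all_J finset.setT; suff -> : x = x' by [].
  by apply: eq_from_tnth => i; rewrite eqx ?inE.
have [M] := ubnP #|J|; elim: M J => // M IHM J; rewrite ltnS => leJ.
have [/small//|ltJ] := leqP #|J| N.
pose g (i : 'I_#|J|) := enum_val i.
have /contrapT[phi [phi_small phiE]] : ~ essential (mkRk (project p g)).
  by move=> /(essential_le (pp_closure_project g pS)); rewrite leqNgt ltJ.
pose z := [tuple tnth x (g i) | i < #|J|].
suff /projectP[x' px' xz] : project p g z.
  exists x' => // i iJ; have := xz (enum_rank_in iJ i).
  by rewrite tnth_mktuple /g enum_rankK_in.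
rewrite -[project p g z]/(pred_of (mkRk (project p g)) z) phiE; apply/allP=> a ain.
have [/= lta una] := phi_small a ain.
have [j jna] : exists j, j \notin tagged a.
  apply/existsP; rewrite -negb_forall; apply/negP=> /forallP alla.
  have := uniq_leq_size (enum_uniq 'I_#|J|) (fun i _ => alla i).
  by rewrite -cardE card_ord size_tuple leqNgt lta.
(* The witness for [J] without the missed coordinate agrees with [x] on every variable of the atom,
   which therefore cannot tell them apart. *)
have [|x' px' eqx] := IHM (J :\ g j).
  have gJ : g j \in J by apply: enum_valP.
  by apply: leq_trans leJ; rewrite [X in _ <= X](cardsD1 (g j)) gJ.
pose z' := [tuple tnth x' (g i) | i < #|J|].
have : pred_of (mkRk (project p g)) z'.
  by apply/projectP; exists x' => // i; rewrite tnth_mktuple.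
rewrite phiE => /allP/(_ a ain).
rewrite (@eq_atom_sat _ _ (tnth z') (tnth z)) // => i ia.
rewrite !tnth_mktuple eqx // !inE enum_valP andbT.
by apply: contraNneq jna => /enum_val_inj <-.
Qed.

End Decomposition.

(** * Near-unanimity polymorphisms *)

Definition preserves (k r m : nat) (f : {ffun 'I_r -> 'I_k} -> 'I_k) (p : npred k m) :=
  forall t : 'I_r -> m.-tuple 'I_k, (forall i, p (t i)) ->
    p [tuple f [ffun i => tnth (t i) j] | j < m].

Definition near_unanimity (k r : nat) (f : {ffun 'I_r -> 'I_k} -> 'I_k) :=
  forall i a b, f [ffun j => if j == i then b else a] = a.

(* The operations preserving [p] form a predicate definable from [p], whose variables
   are the argument tuples.  On any [N] near-unanimous argument tuples some
   projection takes the majority values, so decomposability applies. *)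
Lemma exists_near_unanimity (k m N : nat) (p : npred k m) :
  (forall q, pp_closure [set mkRk p]%classic q -> essential q -> arity q <= N) ->
  exists2 f : {ffun 'I_N.+1 -> 'I_k} -> 'I_k, preserves f p & near_unanimity f.
Proof.
move=> essN.
pose V : finType := {ffun 'I_N.+1 -> 'I_k}.
pose I : finType := ('I_N.+1 * 'I_k * 'I_k)%type.
pose arg (e : I) : V := [ffun j => if j == e.1.1 then e.2 else e.1.2].
(* An assignment to [V] is an operation; this atom says that applying it coordinatewise to the
   tuples of [t] gives a tuple in [p]. *)
pose col (t : {ffun 'I_N.+1 -> m.-tuple 'I_k}) : atom k V :=
  existT (fun p : Rk k => (arity p).-tuple V) (mkRk p)
    [tuple [ffun i => tnth (t i) j] : V | j < m].
pose phi := [seq col t | t <-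
    enum [pred t : {ffun 'I_N.+1 -> m.-tuple 'I_k} | [forall i, p (t i)]]].
have colE w t : atom_sat w (col t) = p [tuple w [ffun i => tnth (t i) j] | j < m].
  rewrite /atom_sat /pred_of /=; congr (p _); apply: eq_from_tnth => j.
  by rewrite tnth_map !tnth_mktuple.
pose z := [tuple (enum_val e).1.2 | e < #|I|].
have /exists_predP[f [fz fphi]] : exists_pred (fun e : 'I_#|I| => arg (enum_val e)) phi z.
  apply: (pp_closure_decomposable essN).
    by apply: pp_closure_exists => a /mapP[t _ ->]; left.
  move=> J leJ.
  (* Only [N] of the [N.+1] positions can be exceptional for an index in [J]; at any other position
     the projection takes the required values. *)
  have [i niJ] : exists i, i \notin [set (enum_val e).1.1 | e in J].
    apply/existsP; rewrite -negb_forall; apply/negP=> /forallP alli.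
    have := leq_trans (leq_imset_card (fun e => (enum_val e).1.1) J) leJ.
    rewrite leqNgt => /negP; apply.
    rewrite -[X in X <= _](card_ord N.+1); apply/subset_leq_card/fintype.subsetP=> i _.
    exact: alli.
  exists [tuple arg (enum_val e) i | e < #|I|].
    apply/exists_predP; exists (fun v : V => v i); split=> [e|].
      by rewrite tnth_mktuple.
    apply/allP=> a /mapP[t]; rewrite mem_enum inE => /forallP pt ->.
    rewrite colE; have <- // : t i = [tuple [ffun i => tnth (t i) j] i | j < m].
    by apply: eq_from_tnth => j; rewrite tnth_mktuple ffunE.
  move=> e eJ; rewrite !tnth_mktuple ffunE; case: eqP => // ie.
  by case/negP: niJ; rewrite ie; apply: imset_f.
exists f.
  move=> t pt; have /(allP fphi) : col (finfun t) \in phi.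
    by apply: map_f; rewrite mem_enum inE; apply/forallP=> i; rewrite ffunE.
  rewrite colE; congr (is_true (p _)); apply: eq_from_tnth => j; rewrite !tnth_mktuple.
  by congr f; apply/ffunP=> i; rewrite !ffunE.
move=> i a b; have := fz (enum_rank (i, a, b)).
by rewrite tnth_mktuple !enum_rankK.
Qed.

Lemma finite_arity_bound (k : nat) (A : set (Rk k)) :
  finite_set A -> exists N, forall p, A p -> arity p <= N.
Proof.
case/finite_seqP => s ->; exists (\max_(p <- s) arity p) => p /= ps.
exact: leq_bigmax_seq.
Qed.

(** * The digraphs obtained from [rho] by fixing the last [n] coordinates *)

Section TwoFirstCoordinates.
Variables (k n r : nat) (rho : npred k n.+2) (f : {ffun 'I_r.+1 -> 'I_k} -> 'I_k).
Hypotheses (f_rho : preserves f rho) (f_nu : near_unanimity f).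
Implicit Types (u v : {ffun 'I_r.+1 -> 'I_k}) (x : n.-tuple 'I_k).

Definition slice x : rel 'I_k := fun a b => rho [tuple of a :: b :: x].

Lemma near_unanimity_idem a : f [ffun=> a] = a.
Proof. by rewrite -[RHS](f_nu ord0 a a); congr f; apply/ffunP=> j; rewrite !ffunE if_same. Qed.

(** Each edge may carry its own parameters, since the loops at different vertices of [looped] may
    have different witnesses. *)
Lemma preserves_slice u v (xs : 'I_r.+1 -> n.-tuple 'I_k) :
  (forall i, slice (xs i) (u i) (v i)) ->
  slice [tuple f [ffun i => tnth (xs i) j] | j < n] (f u) (f v).
Proof.
move=> uv; have := f_rho uv; rewrite /slice; congr (is_true (rho _)).
apply: eq_from_tnth => j; rewrite tnth_mktuple.
case: (unliftP ord0 j) => [j'|] ->; last first.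
  by rewrite tnth0; congr f; apply/ffunP=> i; rewrite ffunE tnth0.
case: (unliftP ord0 j') => [j''|] ->; last first.
  by rewrite tnthS tnth0; congr f; apply/ffunP=> i; rewrite ffunE tnthS tnth0.
rewrite !tnthS tnth_mktuple.
by congr f; apply/ffunP=> i; rewrite !ffunE !tnthS.
Qed.

Lemma preserves_slice_const x u v :
  (forall i, slice x (u i) (v i)) -> slice x (f u) (f v).
Proof.
move=> uv; have := preserves_slice (xs := fun=> x) uv.
congr (is_true (slice _ _ _)); apply: eq_from_tnth => j.
by rewrite tnth_mktuple near_unanimity_idem.
Qed.

Definition looped : {set 'I_k} := [set y | [exists x, slice x y y]].

Lemma stable_looped : stable f looped.
Proof.
move=> u ul.
have /choice[xs uxs] i : exists x, slice x (u i) (u i).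
  by have := ul i; rewrite inE => /existsP.
by rewrite inE; apply/existsP; eexists; apply: preserves_slice uxs.
Qed.

(* If all edges but the [i]-th carry [x] and the [i]-th is a loop carrying [x'], then
   [f] applied to the parameters still returns [x]. *)
Lemma looped_absorbs x : absorbs (slice x) f looped.
Proof.
move=> i u v uv; rewrite inE => /existsP[x' ux'] uvE.
have := @preserves_slice u v (fun j => if j == i then x' else x).
have -> : [tuple f [ffun j => tnth (if j == i then x' else x) l] | l < n] = x.
  apply: eq_from_tnth => l; rewrite tnth_mktuple.
  rewrite -[RHS](f_nu i (tnth x l) (tnth x' l)); congr f.
  by apply/ffunP=> j; rewrite !ffunE; case: ifP.
by apply=> j; case: eqP => [->|/eqP/uvE//]; rewrite -uv.
Qed.

End TwoFirstCoordinates.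

(** * From a walk on [k.+1] vertices to a loop *)

Local Open Scope classical_set_scope.

Theorem theorem7 (k n : nat) (rho : npred k n.+2)
    (hfin : finite_set (pp_closure [set mkRk rho] `&` [set p : Rk k | essential p])) :
  let rho0 (y : 'I_k) : bool :=
    [exists x : n.-tuple 'I_k, rho [tuple of y :: y :: x]] in
  [ffun x : n.-tuple 'I_k => [exists y : 'I_k, rho [tuple of y :: y :: x]]] =
  [ffun x : n.-tuple 'I_k =>
    [exists y : k.+1.-tuple 'I_k,
      [forall i : 'I_k, rho [tuple of tnth y (widen_ord (leqnSn k) i)
                                   :: tnth y (lift ord0 i) :: x]] &&
      [forall i : 'I_k.+1, rho0 (tnth y i)]]] :> npred k n.
Proof.
move=> rho0; apply/ffunP=> x; rewrite !ffunE.
apply/existsP/existsP => [[y yx]|[y /andP[/forallP yE /forallP y0]]].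
  exists [tuple y | _ < k.+1]; apply/andP; split; apply/forallP=> i.
    by rewrite !tnth_mktuple.
  by rewrite tnth_mktuple; apply/existsP; exists x.
have [N essN] := finite_arity_bound hfin.
have [f f_rho f_nu] :
    exists2 f : {ffun 'I_N.+1 -> 'I_k} -> 'I_k, preserves f rho & near_unanimity f.
  by apply: exists_near_unanimity => q qS q_ess; apply: essN.
(* The walk has [k.+1] vertices among [k] values. Past index [k], [inord] returns a default that no
   edge condition reads. *)
have [|t _|m [c cw]] := @closed_walk_of_walk _ (slice rho x) (looped rho)
    (fun t => tnth y (inord t)).
- rewrite card_ord => t ltt; have := yE (Ordinal ltt); rewrite /slice.
  by congr (is_true (rho [tuple of tnth y _ :: tnth y _ :: x]));
    apply: val_inj; rewrite /= inordK // ltnS // ltnW.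
- by rewrite inE; apply: y0.
have [a aE] := absorbing_loop (near_unanimity_idem f_nu)
  (preserves_slice_const f_rho f_nu (x := x)) (stable_looped f_rho)
  (looped_absorbs f_rho f_nu (x := x)) cw.
by exists a.
Qed.
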